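(* Let $R$ be a (not necessarily commutative) ring with $1$. For each integer $k\ge 1$, $R$ satisfies the condition $\mathrm{Cond}(k)$ if and only if $R$ is $k$-stable. Moreover, $R$ satisfies $\mathrm{Cond}(k)$ for every $k\in\{1,2,3,\dots\}$ if and only if $R$ is stably finite.
   Context: Rings are associative with $1$. A ring $S$ is Dedekind finite if $\forall x,y\in S\ (xy=1\rightarrow yx=1)$. A ring $R$ is $k$-stable if the matrix ring $M_k(R)$ of $k\times k$ matrices over $R$ is Dedekind finite, and $R$ is stably finite (also called finitely stable) if it is $k$-stable for every $k\ge1$. The condition $\mathrm{Cond}(k)$ comes from the following communication network: there are $k+1$ sender nodes carrying messages $m_1,\dots,m_{k+1}$, $k$ intermediate nodes, and $k+1$ receiver nodes; there is an edge from every sender to every intermediate node and from every intermediate node to every receiver, and each edge carries an operator (an element of $R$) acting by left multiplication; every node receives the sum of the incoming operator images. $\mathrm{Cond}(k)$ says: whenever the operators are such that for each $i\le k$ the $i$-th receiver obtains exactly $m_i$, the message received by receiver $k+1$ does not depend on $m_{k+1}$. Algebraically, $\mathrm{Cond}(k)$ is the statement: for all $A,B\in M_k(R)$, every column $c\in R^{k\times 1}$ and every row $d\in R^{1\times k}$, if $BA=I_k$ and $Bc=0$, then $dc=0$. (Here $A$ holds the operators from senders $1,\dots,k$ to the intermediate nodes, $c$ those from sender $k+1$, $B$ those from the intermediate nodes to receivers $1,\dots,k$, and $d$ those from the intermediate nodes to receiver $k+1$.) *)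

(* Defs.v *)
From mathcomp Require Import all_boot all_algebra.

Set Implicit Arguments.
Unset Strict Implicit.
Unset Printing Implicit Defensive.

Import GRing.Theory.
Local Open Scope ring_scope.

Definition dedekind_finite (S : pzRingType) : Prop :=
  forall x y : S, x * y = 1 -> y * x = 1.

(* The ring structure on 'M[R]_k is the usual one: its product is mulmx and its
   unit is 1%:M. *)
Definition stable_at (R : pzRingType) (k : nat) : Prop :=
  dedekind_finite 'M[R]_k.

Definition stably_finite (R : pzRingType) : Prop :=
  forall k : nat, (0 < k)%N -> stable_at R k.

(* Network with k + 1 senders, k intermediate nodes and k + 1 receivers:
   A and c hold the operators from senders 1, ..., k and from sender k + 1 to
   the intermediate nodes; B and d hold those from the intermediate nodes to
   receivers 1, ..., k and to receiver k + 1.  The hypotheses say that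
   receivers 1, ..., k obtain exactly their messages, and the conclusion that
   what receiver k + 1 obtains does not depend on the last message. *)
Definition Cond (R : pzRingType) (k : nat) : Prop :=
  forall (A B : 'M[R]_k) (c : 'cV[R]_k) (d : 'rV[R]_k),
    B *m A = 1%:M -> B *m c = 0 -> d *m c = 0.

(* Main.v *)
Require Import Defs.
From mathcomp Require Import all_boot all_algebra.

Set Implicit Arguments.
Unset Strict Implicit.
Unset Printing Implicit Defensive.

Import GRing.Theory.
Local Open Scope ring_scope.

(** If B A = 1, the columns killed by B are exactly those of the form (1 - A B) v: B (1 - A B) = 0,
    and B c = 0 gives c = (1 - A B) c. So A B = 1 iff every such column is zero, that is, iff every
    row d kills it. *)

Lemma stable_at_Cond (R : pzRingType) (k : nat) : stable_at R k -> Cond R k.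
Proof.
move=> stR A B c d BA1 Bc0.
have AB1 : A *m B = 1%:M by apply: stR.
by rewrite -[c]mul1mx -AB1 -mulmxA Bc0 !mulmx0.
Qed.

(* If B A = 1 then B kills every column of 1 - A B, so Cond, applied with d
   the rows of the identity, makes each of these columns zero. *)
Lemma Cond_stable_at (R : pzRingType) (k : nat) : Cond R k -> stable_at R k.
Proof.
move=> condR B A BA1; apply/esym/eqP; rewrite -subr_eq0; apply/eqP.
(* The ring product on ['M[R]_k] is [mulmx] by conversion; this form lets the matrix lemmas
   rewrite. *)
have BA1m : B *m A = 1%:M by [].
have B_defect : B *m (1%:M - A *m B) = 0.
  by rewrite mulmxBr mulmx1 mulmxA BA1m mul1mx subrr.
apply/matrixP=> i j.
have Bcol : B *m col j (1%:M - A *m B) = 0.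
  by rewrite colE mulmxA B_defect mul0mx.
have /matrixP/(_ 0 0) := condR A B _ (row i 1%:M) BA1m Bcol.
by rewrite -row_mul mul1mx !mxE.
Qed.

Theorem mainTheorem2 (R : pzRingType) :
  (forall k : nat, (0 < k)%N -> (Cond R k <-> stable_at R k)) /\
  ((forall k : nat, (0 < k)%N -> Cond R k) <-> stably_finite R).
Proof.
split; first by move=> k _; split; [exact: Cond_stable_at | exact: stable_at_Cond].
split=> hR k k_gt0.
- exact: Cond_stable_at (hR k k_gt0).
- exact: stable_at_Cond (hR k k_gt0).
Qed.
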